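(* Let $P$ be a simple polyhedron with facets indexed by $\mathcal{S}$ and facet normal vector set $V=\{v_i\mid i\in\mathcal{S}\}$, and let $\mathcal{B}$ be a $P$-building set. For each $I\in\mathcal{B}$ let $P_I$ be a truncation of $P$ at the face $F_I$ by a hyperplane normal to the vector $v_I=\sum_{i\in I}v_i$. Then the Minkowski sum of all polyhedra $P_I$ for $I\in\mathcal{B}$ is a $P$-nestohedron of $\mathcal{B}$.
   Context: A full-dimensional polyhedron in $\mathbb{R}^n$ is simple if every nonempty codimension-$k$ face is contained in exactly $k$ facets. Let the facets of $P$ be $\{F_s\mid s\in\mathcal{S}\}$ with (outer) normal vectors $v_s$, let $F_I=\bigcap_{s\in I}F_s$, and let $\Delta(P)=\{I\subseteq\mathcal{S}\mid F_I\neq\emptyset\}$ be the dual simplicial complex. A $P$-building set is a set $\mathcal{B}$ of nonempty faces of $\Delta=\Delta(P)$ containing all singletons $\{s\}$, such that whenever $S_1,S_2\in\mathcal{B}$, $S_1\cap S_2\neq\emptyset$ and $S_1\cup S_2\in\Delta$, then $S_1\cup S_2\in\mathcal{B}$. A subset $N\subseteq\mathcal{B}$ is nested if for any pairwise incomparable $x_1,\dots,x_t\in N$, $t\ge2$, the union $x_1\cup\cdots\cup x_t$ is in $\Delta$ and not in $\mathcal{B}$. A $P$-nestohedron of $\mathcal{B}$ is a simple polyhedron whose dual simplicial complex is isomorphic to the simplicial complex of nested subsets of $\mathcal{B}$. Truncation: an inequality $ax\le b$, with hyperplane $H=\{ax=b\}$, truncates a polyhedron $Q$ at a face $F$ if $F\subset\{ax>b\}$;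 every face $F'$ of $Q$ with $F'\cap F\neq\emptyset$ and $F'\not\subseteq F$ meets $H$; and every face $F'$ of $Q$ with $F'\cap F=\emptyset$ lies in $\{ax<b\}$. The truncation is $Q\cap\{ax\le b\}$. Here $P_I$ is a truncation of $P$ at $F_I$ by an inequality of the form $v_I\cdot x\le b_I$. The Minkowski sum of polyhedra is the set of all sums of points, one from each. *)

(* Defs.v *)
From HB Require Import structures.
From mathcomp Require Import all_boot all_order all_algebra.
From mathcomp Require Import all_classical all_reals.

Set Implicit Arguments.
Unset Strict Implicit.
Unset Printing Implicit Defensive.

Import Order.TTheory GRing.Theory Num.Theory.

Local Open Scope classical_set_scope.
Local Open Scope ring_scope.

Section Polyhedra.
Variables (R : realType) (n : nat).
Implicit Types (P Q F G : set 'rV[R]_n) (a x : 'rV[R]_n) (c : R).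

Definition dot a x : R := \sum_(i < n) a 0 i * x 0 i.

Definition halfspace a c : set 'rV[R]_n := [set x | dot a x <= c].

Definition hyperplane a c : set 'rV[R]_n := [set x | dot a x = c].

(* No boundedness is required; the case m = 0 gives the whole space. *)
Definition polyhedron Q :=
  exists (m : nat) (a : 'I_m -> 'rV[R]_n) (c : 'I_m -> R),
    Q = \bigcap_(i in [set: 'I_m]) halfspace (a i) (c i).

(* The choice a = 0 makes Q itself (c = 0) and the empty set (c > 0) faces. *)
Definition face Q F :=
  exists a c, Q `<=` halfspace a c /\ F = Q `&` hyperplane a c.

Definition affine_hull (A : set 'rV[R]_n) : set 'rV[R]_n :=
  [set y | exists (m : nat) (p : 'I_m -> 'rV[R]_n) (w : 'I_m -> R),
     [/\ forall i, A (p i), \sum_(i < m) w i = 1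
       & y = \sum_(i < m) w i *: p i]].

(* The dimension of a set is that of its affine hull; the empty set has none. *)
Definition has_dim (A : set 'rV[R]_n) (d : nat) :=
  exists (x : 'rV[R]_n) (L : {vspace 'rV[R]_n}),
    affine_hull A = [set x + u | u in [set` L]] /\ (\dim L = d)%N.

Definition has_codim (A : set 'rV[R]_n) (k : nat) :=
  exists2 d, has_dim A d & (d + k = n)%N.

Definition facet Q F := face Q F /\ has_codim F 1.

Definition simple_polyhedron Q :=
  [/\ polyhedron Q,
      has_dim Q n
    & forall F k, face Q F -> F !=set0 -> has_codim F k ->
        ([set G | facet Q G /\ F `<=` G] #= `I_k)%card].

Definition outer_normal Q F a :=
  a != 0 /\ exists c, Q `<=` halfspace a c /\ F = Q `&` hyperplane a c.

Definition truncates a c Q F :=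
  [/\ F `<=` [set x | c < dot a x],
      forall F', face Q F' -> F' `&` F !=set0 -> ~ (F' `<=` F) ->
        F' `&` hyperplane a c !=set0
    & forall F', face Q F' -> F' `&` F = set0 ->
        F' `<=` [set x | dot a x < c]].

Definition is_truncation a Q F Q' :=
  exists c, truncates a c Q F /\ Q' = Q `&` halfspace a c.

Definition minkowski_sum (T : finType) (A : {set T})
    (Q : T -> set 'rV[R]_n) : set 'rV[R]_n :=
  [set x | exists2 y : T -> 'rV[R]_n,
     forall i, i \in A -> Q i (y i) & x = \sum_(i in A) y i].

(* F enumerates the facets of Q without repetition. *)
Definition facet_family (S : finType) Q (F : S -> set 'rV[R]_n) :=
  set_bij [set: S] (facet Q) F.

Definition dual_complex (S : finType) (F : S -> set 'rV[R]_n) : set {set S} :=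
  [set I | \bigcap_(s in [set` I]) F s !=set0].

End Polyhedra.

Section Complexes.
Variable S : finType.
Implicit Types (Delta : set {set S}) (B : {set {set S}}).

Definition building_set Delta B :=
  [/\ forall I, I \in B -> I != finset.set0 /\ Delta I,
      forall s : S, [set s]%SET \in B
    & forall S1 S2, S1 \in B -> S2 \in B -> S1 :&: S2 != finset.set0 ->
        Delta (S1 :|: S2) -> S1 :|: S2 \in B].

(* X is the set of the pairwise incomparable elements x_1, ..., x_t. *)
Definition nested Delta B (N : {set {set S}}) :=
  N \subset B /\
  forall X : {set {set S}}, X \subset N -> (2 <= #|X|)%N ->
    (forall x y, x \in X -> y \in X -> x != y -> ~~ (x \subset y)) ->
    Delta (finset.cover X) /\ finset.cover X \notin B.

Definition nested_complex Delta B : set {set {set S}} :=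
  [set N | nested Delta B N].

Definition vertices (K : set {set S}) : set S := [set s | K [set s]%SET].

End Complexes.

Definition complex_iso (S T : finType) (K : set {set S}) (L : set {set T}) :=
  exists f : S -> T,
    set_bij (vertices K) (vertices L) f /\
    forall X : {set S}, [set` X] `<=` vertices K -> (K X <-> L (f @: X)%SET).

Definition nestohedron (R : realType) (n : nat) (S : finType)
    (Delta : set {set S}) (B : {set {set S}}) (Q : set 'rV[R]_n) :=
  simple_polyhedron Q /\
  exists (T : finType) (G : T -> set 'rV[R]_n),
    facet_family Q G /\ complex_iso (dual_complex G) (nested_complex Delta B).

(* Main.v *)
Require Import Defs.
From HB Require Import structures.
From mathcomp Require Import all_boot all_order all_algebra.
From mathcomp Require Import all_classical all_reals.
From mathcomp Require Import lra.

Set Implicit Arguments.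
Unset Strict Implicit.
Unset Printing Implicit Defensive.

Import Order.TTheory GRing.Theory Num.Theory.

Local Open Scope classical_set_scope.
Local Open Scope ring_scope.

(* Let h be the support numbers of P. The maximum over P_J of v_I is
   h_(I minus J) + c_J when J is contained in I and h_I otherwise, so the sum lies
   in M = {x | v_I x <= H_I for I in B}, H_I being the sum over J of these maxima.
   For nested N and any J in B, the set J is not covered by the members of N
   that do not contain J; hence one point of P_J maximizes all v_I, I in N.
   Conversely the sets I that are tight at a point of the sum are tight at each
   of its summands, and the truncation conditions force them to be nested. Since
   every functional bounded on P is a nonnegative combination of the v_I of a
   nested set, separation gives that the sum is all of M. Finally the normals of a
   nested set are linearly independent, so M is simple with exactly the facets
   v_I x = H_I, which meet precisely along nested sets. *)

(** * Linear functionals and Farkas' lemma *)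

Section Dot.
Variables (R : realType) (n : nat).
Implicit Types (a x y d : 'rV[R]_n) (k : R).

Lemma dotC a x : dot a x = dot x a.
Proof. by apply: eq_bigr => i _; rewrite mulrC. Qed.

Lemma dot_scalar a : scalar (dot a).
Proof.
move=> k x y; rewrite /dot mulr_sumr -big_split; apply: eq_bigr => i _ /=.
by rewrite !mxE; lra.
Qed.

HB.instance Definition _ a :=
  GRing.isLinear.Build R 'rV[R]_n R *%R (dot a) (dot_scalar a).

Lemma dotDr a x y : dot a (x + y) = dot a x + dot a y.
Proof. exact: raddfD. Qed.

Lemma dotBr a x y : dot a (x - y) = dot a x - dot a y.
Proof. exact: raddfB. Qed.

Lemma dotZr a k x : dot a (k *: x) = k * dot a x.
Proof. exact: linearZ. Qed.

Lemma dot_sumr I (r : seq I) (P : pred I) a (x : I -> 'rV[R]_n) :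
  dot a (\sum_(i <- r | P i) x i) = \sum_(i <- r | P i) dot a (x i).
Proof. exact: raddf_sum. Qed.

Lemma dot_suml I (r : seq I) (P : pred I) x (a : I -> 'rV[R]_n) :
  dot (\sum_(i <- r | P i) a i) x = \sum_(i <- r | P i) dot (a i) x.
Proof. by rewrite dotC dot_sumr; apply: eq_bigr => i _; rewrite dotC. Qed.

Lemma dot_eq0 a : (forall x, dot a x = 0) -> a = 0.
Proof.
move=> a0; apply/rowP => j; have := a0 (delta_mx 0 j).
rewrite /dot (bigD1 j) //= big1 ?mxE ?eqxx ?addr0 ?mulr1 // => i ij.
by rewrite mxE eqxx /= (negbTE ij) mulr0.
Qed.

End Dot.

(* Bartl's proof: if the last functional [a i0] is needed, some x0 violates the
   claim without it, and one projects onto the kernel of [a i0] along x0. *)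
Lemma farkas (R : realType) (V : lmodType R) (T : finType) (A : {set T})
    (a : T -> V -> R) (u : V -> R) :
  (forall i, scalar (a i)) -> scalar u ->
  (forall x, (forall i, i \in A -> a i x <= 0) -> u x <= 0) ->
  exists2 l : T -> R, (forall i, 0 <= l i) &
    forall x, u x = \sum_(i in A) l i * a i x.
Proof.
have [m] := ubnP #|A|; elim: m A a u => // m IH A a u; rewrite ltnS => Am al ul.
have [->|[i0 i0A]] := finset.set_0Vmem A => h.
  exists (fun=> 0) => // x; rewrite finset.big_set0.
  have u0 : u 0 = 0 by have := ul 1 0 0; rewrite scale1r addr0; lra.
  have hx y : u y <= 0 by apply: h => i; rewrite inE.
  have := ul (-1) x 0; rewrite addr0 => uN.
  by have := hx x; have := hx (-1 *: x); rewrite uN; lra.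
have A'm : (#|A :\ i0| < m)%N.
  by move: Am; rewrite (cardsD1 i0 A) i0A.
have [h'|/existsNP[x0 /not_implyP[x0A /negP]]] :=
    pselect (forall x, (forall i, i \in A :\ i0 -> a i x <= 0) -> u x <= 0).
  have [l l0 lE] := IH _ _ _ A'm al ul h'.
  exists (fun i => if i == i0 then 0 else l i) => [i|x]; first by case: ifP.
  rewrite lE [RHS](finset.big_setD1 i0) //= eqxx mul0r add0r.
  by apply: eq_bigr => i; rewrite !inE => /andP[/negbTE->].
rewrite -ltNge => ux0.
have ai0 : 0 < a i0 x0.
  rewrite ltNge; apply/negP => ai0; move: ux0; rewrite ltNge h // => i iA.
  by have [->//|ii0] := eqVneq i i0; apply: x0A; rewrite !inE ii0.
pose p x := x - (a i0 x / a i0 x0) *: x0.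
have pE f x : scalar f -> f (p x) = f x - (a i0 x / a i0 x0) * f x0.
  by move=> fl; rewrite /p [x - _]addrC -scaleNr fl; lra.
have ps f : scalar f -> scalar (f \o p).
  by move=> fl k x y /=; rewrite !pE // fl al; lra.
have [|l l0 lE] := IH (A :\ i0) (fun i => a i \o p) (u \o p) A'm
    (fun i => ps _ (al i)) (ps _ ul).
  move=> x hx; apply: h => i iA; have [->|ii0] := eqVneq i i0.
    by rewrite pE // divfK ?gt_eqF// subrr.
  by apply: hx; rewrite !inE ii0.
pose s := \sum_(i in A :\ i0) l i * a i x0.
have s0 : s <= 0.
  by apply: sumr_le0 => i iA; rewrite mulr_ge0_le0 // x0A.
exists (fun i => if i == i0 then (u x0 - s) / a i0 x0 else l i) => [i|x].
  by case: ifP => // _; rewrite divr_ge0 ?(ltW ai0) ?subr_ge0 ?(le_trans s0) ?ltW.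
rewrite (finset.big_setD1 i0) //= eqxx.
rewrite (eq_bigr (fun i => l i * a i x)); last first.
  by move=> i; rewrite !inE => /andP[/negbTE->].
have := lE x; rewrite /= pE //.
under eq_bigr => i _ do rewrite pE // mulrBr mulrCA.
rewrite sumrB -mulr_sumr -/s => /eqP; rewrite subr_eq => /eqP ->.
lra.
Qed.

(** * Inequality systems and their faces *)

Lemma uniform_step (R : realType) (T : finType) (p : T -> R -> Prop) :
  (forall i, exists e : R, 0 < e /\ forall t, 0 < t <= e -> p i t) ->
  exists2 t : R, 0 < t & forall i, p i t.
Proof.
move=> /choice[e e0].
exists (\big[Order.min/1]_i e i).
  by apply: lt_bigmin => // i _; case: (e0 i).
move=> i; case: (e0 i) => ei0; apply; rewrite bigmin_le_cond // andbT.
by apply: lt_bigmin => // j _; case: (e0 j).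
Qed.

Section Hpoly.
Variables (R : realType) (n : nat) (T : finType).
Variables (a : T -> 'rV[R]_n) (b : T -> R).
Implicit Types (x y z d : 'rV[R]_n) (A : {set T}).

Definition hpoly : set 'rV[R]_n := [set x | forall i, dot (a i) x <= b i].

Definition active x : {set T} := [set i | dot (a i) x == b i]%SET.

Definition hface A : set 'rV[R]_n := [set x | hpoly x /\ A \subset active x].

(** Linear independence of the [a i] with [i] in [A], phrased as the existence of directions on
    which they take prescribed values. *)
Definition indep A :=
  forall be : T -> R, exists d, forall i, i \in A -> dot (a i) d = be i.

Lemma activeP x i : reflect (dot (a i) x = b i) (i \in active x).
Proof. by rewrite inE; apply: eqP. Qed.

Lemma inactive_lt x i : hpoly x -> i \notin active x -> dot (a i) x < b i.
Proof. by rewrite inE lt_neqAle => -> ->. Qed.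

Lemma hfaceP A x i : hface A x -> i \in A -> dot (a i) x = b i.
Proof. by case=> _ /fintype.subsetP Ax /Ax /activeP. Qed.

Lemma hface_le A A' : A \subset A' -> hface A' `<=` hface A.
Proof. by move=> AA' x [Px /(fintype.subset_trans AA')]. Qed.

Lemma slack_step x d : hpoly x ->
  exists2 t : R, 0 < t &
    forall i, i \notin active x -> dot (a i) (x + t *: d) < b i.
Proof.
move=> Px; apply: (@uniform_step R T (fun i t =>
  i \notin active x -> dot (a i) (x + t *: d) < b i)) => i.
have [iA|iA] := boolP (i \in active x); first by exists 1; split.
have := inactive_lt Px iA; rewrite -subr_gt0 => s0.
have d0 : 0 < 1 + `|dot (a i) d| by rewrite ltr_pwDl.
exists ((b i - dot (a i) x) / (1 + `|dot (a i) d|)).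
split; first exact: divr_gt0.
move=> t /andP[t0]; rewrite ler_pdivlMr // => tle _.
rewrite dotDr dotZr; have := ler_norm (dot (a i) d).
by move=> /(ler_wpM2l (ltW t0)); lra.
Qed.

(** Inactive constraints stay strict by [slack_step]; an active one changes by [t * dot (a i) d], so
    it survives exactly when this vanishes. *)
Lemma step x d : hpoly x -> (forall i, i \in active x -> dot (a i) d <= 0) ->
  exists t : R, [/\ 0 < t, hpoly (x + t *: d) & active (x + t *: d) =
     [set i in active x | dot (a i) d == 0]%SET].
Proof.
move=> Px dA; have [t t0 tP] := slack_step d Px; exists t; split=> //.
  move=> i; have [iA|/tP/ltW//] := boolP (i \in active x).
  rewrite dotDr dotZr (activeP _ _ iA).
  by have := dA _ iA; nra.
apply/finset.setP => i; rewrite !inE.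
have [iA|iA] := boolP (i \in active x); last first.
  by rewrite lt_eqF ?tP//; move: iA; rewrite inE => /negbTE->.
move/activeP: iA => iA; rewrite iA eqxx /= dotDr dotZr iA -subr_eq0 addrAC subrr.
by rewrite add0r mulf_eq0 gt_eqF.
Qed.

Lemma hpoly_mid x y : hpoly x -> hpoly y ->
  hpoly (2^-1 *: (x + y)) /\
  active (2^-1 *: (x + y)) = active x :&: active y.
Proof.
move=> Px Py; split.
  by move=> i; rewrite dotZr dotDr; have := Px i; have := Py i; lra.
apply/finset.setP => i; rewrite !inE dotZr dotDr; have := Px i; have := Py i.
move=> yi xi; apply/eqP/andP => [h|[/eqP-> /eqP->]]; last by lra.
by split; apply/eqP; lra.
Qed.

(** A midpoint is active only where both ends are, so passing to midpoints shrinks the active set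
    until it lies in all others. The resulting [z] acts as a relative interior point of [C]. *)
Lemma generic_point (C : set 'rV[R]_n) : C `<=` hpoly -> C !=set0 ->
    (forall x y, C x -> C y -> C (2^-1 *: (x + y))) ->
  exists2 z, C z & forall x, C x -> active z \subset active x.
Proof.
move=> CP [x0 Cx0] Cmid.
have [m] := ubnP #|active x0|; elim: m x0 Cx0 => // m IH x0 Cx0 /ltnSE x0m.
have [h|/existsNP[x /not_implyP[Cx /negP xx0]]] :=
  pselect (forall x, C x -> active x0 \subset active x); first by exists x0.
apply: (IH (2^-1 *: (x0 + x))); first exact: Cmid.
rewrite (hpoly_mid (CP _ Cx0) (CP _ Cx)).2 (leq_trans _ x0m) // proper_card //.
rewrite properE finset.subsetIl /= finset.subsetI fintype.subxx.
exact: xx0.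
Qed.

(** Independence provides a direction that keeps the constraints in [A] tight and strictly leaves
    the other active ones. *)
Lemma exact_point A x : hface A x -> indep (active x) ->
  exists2 z, hpoly z & active z = A.
Proof.
move=> [Px Ax] ix; have [d dE] := ix (fun i => if i \in A then 0 else -1).
have [|t [_ Pt At]] := @step x d Px.
  by move=> i iA; rewrite dE //; case: ifP => // _; rewrite lerN10.
exists (x + t *: d) => //; rewrite At; apply/finset.setP => i; rewrite inE.
have [iA|/negP iA] := boolP (i \in active x); last first.
  by symmetry; apply/negP => /(fintype.subsetP Ax).
by rewrite dE //; case: ifP => _; rewrite ?eqxx // oppr_eq0 oner_eq0.
Qed.

Lemma face_hface (F : set 'rV[R]_n) z : face hpoly F -> F z ->
  (forall x, F x -> active z \subset active x) -> F = hface (active z).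
Proof.
move=> [w [c [Pw FE]]] Fz zmin; have [Pz wz] : hpoly z /\ dot w z = c.
  by move: Fz; rewrite FE.
apply/seteqP; split=> [x Fx|x [Px xA]].
  by split; [move: Fx; rewrite FE => -[] | exact: zmin].
(* The segment from [x] to [z] can be prolonged slightly beyond [z]; if [w] were smaller at [x] than
   at [z], it would exceed its maximum [c] there. *)
have [|t [t0 Pt _]] := @step z (z - x) Pz.
  move=> i iz; rewrite dotBr (activeP _ _ iz).
  by rewrite (activeP _ _ (fintype.subsetP xA _ iz)) subrr.
rewrite FE; split => //; apply/eqP; rewrite eq_le; apply/andP; split.
  exact: Pw.
have := Pw _ Pt; rewrite /halfspace /= dotDr dotZr dotBr wz gerDl pmulr_rle0 //.
by rewrite subr_le0.
Qed.

Lemma sum_tight A x : hpoly x ->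
  (\sum_(i in A) dot (a i) x == \sum_(i in A) b i) = (A \subset active x).
Proof.
move=> Px; rewrite eq_sym -subr_eq0 -sumrB psumr_eq0 => [|j _]; last first.
  by rewrite subr_ge0.
apply/seq.allP/fintype.subsetP => [h i iA|h i _].
  by have := h i; rewrite mem_index_enum iA subr_eq0 inE eq_sym => /(_ isT).
by apply/implyP => /h/activeP ->; rewrite subrr.
Qed.

Lemma hface_face A : face hpoly (hface A).
Proof.
exists (\sum_(i in A) a i), (\sum_(i in A) b i); split=> [x Px|].
  by rewrite /halfspace /= dot_suml ler_sum.
apply/seteqP; split=> x -[Px xA]; split=> //; move: xA;
  by rewrite /hyperplane /= dot_suml -sum_tight // => /eqP.
Qed.

Lemma face_generic (F : set 'rV[R]_n) : face hpoly F -> F !=set0 ->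
  exists z, [/\ hpoly z, F z & F = hface (active z)].
Proof.
move=> fF F0; have [w [c [Pw FE]]] := fF.
have FP : F `<=` hpoly by rewrite FE; exact: subIsetl.
have [||z Fz zmin] := @generic_point F FP => //.
  rewrite FE => x y [Px xc] [Py yc]; split; first by case: (hpoly_mid Px Py).
  by rewrite /hyperplane /= dotZr dotDr xc yc; lra.
by exists z; split=> //; [exact: FP | exact: face_hface].
Qed.

End Hpoly.

(** * Dimensions of faces *)

Section Dimension.
Variables (R : realType) (n : nat) (T : finType).
Variables (a : T -> 'rV[R]_n) (b : T -> R).
Implicit Types (x y z d u : 'rV[R]_n) (A : {set T}).

(** Joint evaluation of the functionals in [A]. When [A] is the active set of a point of the
    polyhedron, the kernel is the direction space of the corresponding face and the rank is its
    codimension. *)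
Definition ev A (d : 'rV[R]_n) : 'rV[R]_#|A| :=
  \row_k dot (a (enum_val k)) d.

Lemma ev_linear A : linear (ev A).
Proof. by move=> k x y; apply/rowP => j; rewrite !mxE dotDr dotZr. Qed.

HB.instance Definition _ A :=
  GRing.isLinear.Build R 'rV[R]_n 'rV[R]_#|A| *:%R (ev A) (ev_linear A).

Definition evf A := linfun (ev A).

Lemma evfE A d i (iA : i \in A) : evf A d 0 (enum_rank_in iA i) = dot (a i) d.
Proof. by rewrite lfunE mxE enum_rankK_in. Qed.

Lemma evf_kerP A u :
  reflect (forall i, i \in A -> dot (a i) u = 0) (u \in lker (evf A)).
Proof.
rewrite memv_ker; apply: (iffP eqP) => [u0 i iA|u0].
  by rewrite -(evfE u iA) u0 mxE.
by apply/rowP => k; rewrite lfunE !mxE u0 ?enum_valP.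
Qed.

Lemma dim_evf A : (\dim (lker (evf A)) + \dim (limg (evf A)) = n)%N.
Proof.
have := limg_ker_dim (evf A) fullv.
by rewrite capfv dimvf /dim /= mul1n.
Qed.

Lemma indep_dim A : indep a A <-> \dim (limg (evf A)) = #|A|.
Proof.
have dimA : \dim {: 'rV[R]_#|A|} = #|A| by rewrite dimvf /dim /= mul1n.
split=> [iA|dA].
  suff -> : limg (evf A) = fullv by [].
  apply/eqP; rewrite eqEsubv subvf; apply/subvP => w _.
  have [d dE] := iA (fun i => \sum_(k | enum_val k == i) w 0 k).
  apply/memv_imgP; exists d; rewrite ?memvf //; apply/rowP => k.
  rewrite lfunE mxE dE ?enum_valP // (big_pred1 k) // => j.
  by rewrite (inj_eq enum_val_inj).
move=> be; have: \row_k be (enum_val k) \in limg (evf A).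
  have /eqP -> : limg (evf A) == fullv by rewrite eqEdim subvf dA dimA leqnn.
  exact: memvf.
move=> /memv_imgP[d _ dE]; exists d => i iA.
by rewrite -(evfE d iA) -dE mxE enum_rankK_in.
Qed.

Lemma coset_eq_dim x y (L M : {vspace 'rV[R]_n}) :
  [set x + u | u in [set` L]] = [set y + u | u in [set` M]] -> \dim L = \dim M.
Proof.
have sub x' y' (L' M' : {vspace 'rV[R]_n}) :
    [set x' + u | u in [set` L']] `<=` [set y' + u | u in [set` M']] ->
  (L' <= M')%VS.
  move=> h; apply/subvP => u uL.
  have [|w wM wE] := h x'; first by exists 0; rewrite ?addr0 //= mem0v.
  have [|w' wM' wE'] := h (x' + u); first by exists u.
  suff -> : u = w' - w by rewrite rpredB.
  by rewrite -[u](addKr x') -wE' -wE; apply/rowP => i; rewrite !mxE; lra.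
move=> e; congr (\dim _); apply/eqP; rewrite eqEsubv; apply/andP.
by split; [apply: (sub x y)|apply: (sub y x)]; rewrite e.
Qed.

Lemma has_dim_hface z (d : nat) : hpoly a b z ->
  has_dim (hface a b (active a b z)) d <-> d = \dim (lker (evf (active a b z))).
Proof.
set A := active a b z => Pz.
have zA : hface a b A z by split.
suff h : affine_hull (hface a b A) = [set z + u | u in [set` lker (evf A)]].
  split=> [[x [L [xL <-]]]|->]; first by apply: (@coset_eq_dim x z); rewrite -xL.
  by exists z, (lker (evf A)).
apply/seteqP; split=> [y [m [p [w [pA w1 ->]]]]|_ [u /= uA <-]].
  exists (\sum_(i < m) w i *: (p i - z)).
    apply: rpred_sum => i _; apply/rpredZ/evf_kerP => j jA.
    by rewrite dotBr (hfaceP (pA i) jA) (hfaceP zA jA) subrr.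
  under eq_bigr do rewrite scalerBr.
  by rewrite sumrB -scaler_suml w1 scale1r addrC subrK.
(* A short move along a kernel direction stays in the face, and [z + u] is an affine combination of
   [z] and [z + t *: u]. *)
have [|t [t0 Pt At]] := step Pz (d := u).
  by move=> i iA; rewrite (evf_kerP _ _ uA).
exists 2, (fun i : 'I_2 => if i == 0 then z else z + t *: u),
  (fun i : 'I_2 => if i == 0 then 1 - t^-1 else t^-1); split.
- move=> i; case: ifP => // _; split=> //; rewrite At.
  apply/fintype.subsetP => j jA; rewrite inE jA.
  by rewrite (evf_kerP _ _ uA) ?eqxx.
- by rewrite !big_ord_recl big_ord0 /=; lra.
- rewrite !big_ord_recl big_ord0 /= addr0 scalerDr scalerA mulVf ?gt_eqF //.
  by rewrite addrA -scalerDl subrK !scale1r.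
Qed.

Lemma has_codim_hface z k : hpoly a b z ->
  has_codim (hface a b (active a b z)) k ->
  k = \dim (limg (evf (active a b z))).
Proof.
move=> Pz [d /(has_dim_hface _ Pz)-> h].
by apply/eqP; rewrite -(eqn_add2l (\dim (lker (evf (active a b z))))) h dim_evf.
Qed.

Lemma codim_hface z : hpoly a b z ->
  has_codim (hface a b (active a b z)) (\dim (limg (evf (active a b z)))).
Proof.
move=> Pz; exists (\dim (lker (evf (active a b z)))); last exact: dim_evf.
by rewrite has_dim_hface.
Qed.

End Dimension.

(** * Simple presentations *)

Lemma card_imset_I (T : finType) (U : Type) (f : T -> U) (A : {set T}) :
  injective f -> (f @` [set` A] #= `I_#|A|)%card.
Proof.
move=> fI; apply: card_eq_trans (inj_card_eq (in2W fI)) _.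
suff <- : (fun i => index i (enum A)) @` [set` A] = `I_#|A|.
  apply/card_esym/inj_card_eq => i j /set_mem/= iA /set_mem/= jA.
  by apply: (@index_inj _ i (enum A)); rewrite mem_enum.
apply/seteqP; split=> [_ [i iA <-]|k kA] /=.
  by rewrite cardE index_mem mem_enum.
exists (enum_val (Ordinal kA)); first exact: enum_valP.
rewrite /= (enum_val_nth (enum_val (Ordinal kA))) index_uniq ?enum_uniq //.
by rewrite -cardE.
Qed.

Lemma affine_hull_nonempty (R : realType) (n : nat) (A : set 'rV[R]_n) y :
  affine_hull A y -> A !=set0.
Proof.
move=> [[|m] [p [w [pA w1 _]]]]; last by exists (p ord0).
by move: w1; rewrite big_ord0 => /esym/eqP; rewrite oner_eq0.
Qed.

Lemma has_dim_nonempty (R : realType) (n : nat) (A : set 'rV[R]_n) d :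
  has_dim A d -> A !=set0.
Proof.
move=> [x [L [AL _]]]; apply: (@affine_hull_nonempty _ _ _ x).
by rewrite AL; exists 0; rewrite ?addr0 //= mem0v.
Qed.

Lemma polyhedron_hpoly (R : realType) (n : nat) (T : finType)
  (a : T -> 'rV[R]_n) (b : T -> R) : polyhedron (hpoly a b).
Proof.
exists #|T|, (a \o enum_val), (b \o enum_val); apply/seteqP.
split=> [x Px k _|x Px i]; first exact: Px.
by have := Px (enum_rank i) I; rewrite /halfspace /= enum_rankK.
Qed.

Section SimplePresentation.
Variables (R : realType) (n : nat) (T : finType).
Variables (a : T -> 'rV[R]_n) (b : T -> R).

Hypothesis P0 : hpoly a b !=set0.
Hypothesis Pindep : forall x, hpoly a b x -> indep a (active a b x).
Hypothesis Ptight : forall i, exists2 x, hpoly a b x & i \in active a b x.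

Let exact_tight i : exists2 z, hpoly a b z & active a b z = [set i]%SET.
Proof.
have [x Px ix] := Ptight i; apply: (@exact_point _ _ _ a b _ x) (Pindep Px).
by split; rewrite ?finset.sub1set.
Qed.

Let hface1_inj : injective (fun i => hface a b [set i]%SET).
Proof.
move=> i j; have [z Pz zi] := exact_tight i => ij.
have : hface a b [set j]%SET z by rewrite -ij; split; rewrite ?zi.
by move=> [_]; rewrite zi finset.sub1set inE => /eqP.
Qed.

Lemma codim_hface_indep z k : hpoly a b z ->
  has_codim (hface a b (active a b z)) k -> k = #|active a b z|.
Proof.
move=> Pz /(has_codim_hface Pz)->; apply/indep_dim; exact: Pindep.
Qed.

Lemma facet_hpoly G : facet (hpoly a b) G <->
  exists i, G = hface a b [set i]%SET.
Proof.
split=> [[fG [d dG d1]]|[i ->]]; last first.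
  split; first exact: hface_face.
  have [z Pz zi] := exact_tight i; have := codim_hface Pz.
  have /indep_dim -> := Pindep Pz.
  by rewrite zi cards1.
have [z [Pz Gz GE]] := face_generic fG (has_dim_nonempty dG).
have : has_codim G 1 by exists d.
rewrite GE => /(codim_hface_indep Pz)/esym/eqP/cards1P[i zi].
by exists i; rewrite zi.
Qed.

Lemma facet_family_hpoly :
  facet_family (hpoly a b) (fun i => hface a b [set i]%SET).
Proof.
split=> [i _|i j _ _|G /facet_hpoly[i ->]]; last by exists i.
- by apply/facet_hpoly; exists i.
- exact: hface1_inj.
Qed.

(** A point without active constraints gives full dimension. A face with generic point [z] has as
    codimension the number of constraints active at [z], and these index the facets containing
    it. *)
Lemma simple_hpoly : simple_polyhedron (hpoly a b).
Proof.
split; first exact: polyhedron_hpoly.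
  have [x Px] := P0.
  have [|z Pz z0] := @exact_point _ _ _ a b finset.set0 x _ (Pindep Px).
    by split; rewrite ?finset.sub0set.
  have [d dz] : has_codim (hface a b (active a b z)) 0.
    have := codim_hface Pz.
    by have /indep_dim -> := Pindep Pz; rewrite z0 cards0.
  rewrite addn0 => dn; move: dz; rewrite dn.
  suff -> : hpoly a b = hface a b (active a b z) by [].
  by rewrite z0; apply/seteqP; split=> y; [split; rewrite ?finset.sub0set|case].
move=> F k fF F0; have [z [Pz Fz ->]] := face_generic fF F0.
move=> /(codim_hface_indep Pz)->.
suff -> : [set G | facet (hpoly a b) G /\ hface a b (active a b z) `<=` G] =
    (fun i => hface a b [set i]%SET) @` [set` active a b z].
  exact/card_imset_I/hface1_inj.
apply/seteqP; split=> [G [/facet_hpoly[i ->] zi]|_ [i /= iz <-]].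
  exists i => //=; have /zi : hface a b (active a b z) z by split.
  by move=> [_]; rewrite finset.sub1set.
by split; [apply/facet_hpoly; exists i|apply: hface_le; rewrite finset.sub1set].
Qed.

End SimplePresentation.

(** * Facet presentation of a full-dimensional polyhedron *)

(** Take a presentation with the fewest inequalities: if no point violated the [i]-th one alone,
    that inequality could be dropped. *)
Lemma irredundant_hpoly (R : realType) (n : nat) (Q : set 'rV[R]_n) :
    polyhedron Q ->
  exists (m : nat) (a : 'I_m -> 'rV[R]_n) (b : 'I_m -> R),
    Q = hpoly a b /\ forall i, exists y,
      (forall j, j != i -> dot (a j) y <= b j) /\ b i < dot (a i) y.
Proof.
move=> [m0 [a0 [b0 Q0]]].
pose p m := `[< exists (a : 'I_m -> 'rV[R]_n) (b : 'I_m -> R), Q = hpoly a b >].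
have ep : exists m, p m.
  exists m0; apply/asboolP; exists a0, b0; rewrite Q0.
  by apply/seteqP; split=> [x Px i|x Px i _]; apply: Px.
case: (ex_minnP ep) => -[|m] /asboolP[a [b QE]] mmin.
  by exists 0%N, a, b; split=> // -[].
exists m.+1, a, b; split=> // i; apply: contrapT => noy.
suff /mmin : p m by rewrite ltnn.
apply/asboolP; exists (a \o lift i), (b \o lift i); rewrite QE.
apply/seteqP; split=> x Px j /=; first exact: Px.
have Px' k : k != i -> dot (a k) x <= b k.
  by rewrite eq_sym => ik; case: (unlift_some ik) => l -> _; apply: Px.
have [->|/Px'//] := eqVneq j i.
by rewrite leNgt; apply/negP => xi; apply: noy; exists x.
Qed.

Lemma hyperplane_affine_hull (R : realType) (n : nat) (A : set 'rV[R]_n) w c :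
  A `<=` hyperplane w c -> affine_hull A `<=` hyperplane w c.
Proof.
move=> Ac _ [m [p [l [pA l1 ->]]]]; rewrite /hyperplane /= dot_sumr.
under eq_bigr do rewrite dotZr (Ac _ (pA _)).
by rewrite -mulr_suml l1 mul1r.
Qed.

Lemma affine_hull_full (R : realType) (n : nat) (A : set 'rV[R]_n) y :
  has_dim A n -> affine_hull A y.
Proof.
move=> [x [L [-> dL]]]; exists (y - x); rewrite ?subrKC //=.
suff -> : L = fullv by rewrite memvf.
by apply/eqP; rewrite eqEdim subvf dimvf /dim /= mul1n dL.
Qed.

(** Each irredundant inequality defines a facet, hence some [F s]; the two functionals supporting
    [Q] along this facet are positive multiples of each other, so the inequality for [v s] implies
    the given one. *)
Lemma facet_presentation (R : realType) (n : nat) (Q : set 'rV[R]_n)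
    (S : finType) (F : S -> set 'rV[R]_n) (v : S -> 'rV[R]_n) :
    polyhedron Q -> has_dim Q n -> facet_family Q F ->
    (forall s, outer_normal Q (F s) (v s)) ->
  exists h : S -> R, Q = hpoly v h /\ forall s, F s = hface v h [set s]%SET.
Proof.
move=> /irredundant_hpoly[m [a [b [QE irr]]]] Qn [Ffacet Finj Fsurj] hv.
have /choice[h hP] : forall s, exists c : R,
    Q `<=` halfspace (v s) c /\ F s = Q `&` hyperplane (v s) c.
  by move=> s; case: (hv s) => _ [c hc]; exists c.
suff QvE : Q = hpoly v h.
  exists h; split=> // s; rewrite (hP s).2 QvE; apply/seteqP; split=> x [Px xs].
    by split=> //; rewrite finset.sub1set; apply/activeP.
  by split=> //; move: xs; rewrite finset.sub1set => /activeP.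
apply/seteqP; split=> [x Qx s|x Px]; first exact: (hP s).1.
(* A generic point is interior: a constraint active there would be an equation on [Q], hence on its
   affine hull, the whole space. *)
have [z Qz zint] : exists2 z, Q z & forall i, dot (a i) z < b i.
  have [|||z Qz zmin] := @generic_point _ _ _ a b Q; first by rewrite QE.
  - exact: has_dim_nonempty Qn.
  - by rewrite QE => y y' Py Py'; case: (hpoly_mid Py Py').
  exists z => // i; have [y [_ yi]] := irr i.
  apply: inactive_lt; first by rewrite -QE.
  apply/negP => iz; suff : dot (a i) y = b i by lra.
  apply: (@hyperplane_affine_hull _ _ Q) (affine_hull_full y Qn).
  by move=> q Qq; apply/activeP; apply: (fintype.subsetP (zmin _ Qq)).
rewrite QE => i; have [y [yj yi]] := irr i; have zi := zint i.
pose d := y - z; pose de := dot (a i) d.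
have de0 : 0 < de by rewrite /de dotBr; lra.
(* [w] is where the segment from the interior point [z] to [y] crosses the [i]-th hyperplane; no
   other constraint is active at [w]. *)
pose t := (b i - dot (a i) z) / de; pose w := z + t *: d.
have t0 : 0 < t by rewrite divr_gt0 // subr_gt0.
have t1 : t < 1 by rewrite ltr_pdivrMr // /de dotBr; lra.
have wi : dot (a i) w = b i.
  by rewrite /w dotDr dotZr -/de /t divfK ?gt_eqF//; lra.
have wj j : j != i -> dot (a j) w < b j.
  move=> /yj; rewrite dotDr dotZr dotBr; have := zint j; nra.
have Pw : hpoly a b w.
  by move=> j; have [->|/wj/ltW//] := eqVneq j i; rewrite wi.
have wA : active a b w = [set i]%SET.
  apply/finset.setP => j; rewrite !inE; have [->|/wj ji] := eqVneq j i.
    by rewrite wi eqxx.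
  by rewrite lt_eqF.
have /Fsurj[s _ sE] : facet Q (hface a b [set i]%SET).
  split; first by rewrite QE; apply: hface_face.
  have := codim_hface Pw; rewrite wA.
  have /indep_dim -> : indep a [set i]%SET.
    move=> be; exists ((be i / de) *: d) => j; rewrite inE => /eqP ->.
    by rewrite dotZr -/de divfK ?gt_eqF.
  by rewrite cards1.
have ws : dot (v s) w = h s.
  have : F s w by rewrite sE; split; rewrite ?wA.
  by rewrite (hP s).2 => -[].
have ker u : dot (a i) u = 0 -> dot (v s) u = 0.
  move=> u0; have [|e [e0 Pe Ae]] := step Pw (d := u).
    by move=> j; rewrite wA inE => /eqP ->; rewrite u0.
  have : F s (w + e *: u).
    by rewrite sE; split=> //; rewrite Ae wA finset.sub1set !inE u0 !eqxx.
  rewrite (hP s).2 => -[_]; rewrite /hyperplane /= dotDr dotZr ws.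
  by move/eqP; rewrite -subr_eq0 addrAC subrr add0r mulf_eq0 gt_eqF //= => /eqP.
pose k := dot (v s) d / de.
have vE u : dot (v s) u = k * dot (a i) u.
  have : dot (v s) (u - (dot (a i) u / de) *: d) = 0.
    by apply: ker; rewrite dotBr dotZr -/de divfK ?gt_eqF// subrr.
  by rewrite dotBr dotZr /k; lra.
have k0 : 0 < k.
  rewrite lt_neqAle; apply/andP; split; last first.
    have : dot (v s) z <= h s by apply: (hP s).1.
    rewrite -ws /w dotDr dotZr lerDl pmulr_rge0 // => ?.
    by rewrite divr_ge0 // ltW.
  apply/eqP => k0; case: (hv s) => /eqP + _; apply; apply: dot_eq0 => u.
  by rewrite vE -k0 mul0r.
by have := Px s; rewrite -ws !vE wi ler_pM2l.
Qed.

(** The facets through the face of the constraints active at [x] are indexed by these constraints.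
    Simplicity makes their number the codimension, which is the rank of the evaluation map. *)
Lemma simple_indep (R : realType) (n : nat)
    (S : finType) (v : S -> 'rV[R]_n) (h : S -> R) x :
    simple_polyhedron (hpoly v h) ->
    facet_family (hpoly v h) (fun s => hface v h [set s]%SET) ->
    hpoly v h x -> indep v (active v h x).
Proof.
move=> [_ _ simple] [Ffacet Finj Fsurj] Px; apply/indep_dim.
have xF : hface v h (active v h x) x by split.
have := simple _ _ (hface_face v h (active v h x)) (ex_intro _ x xF)
  (codim_hface Px).
set G := [set _ | _].
suff -> : G = (fun s => hface v h [set s]%SET) @` [set` active v h x].
  rewrite (card_eql (card_imset_I _ _)) => [/card_eq_II//|s t].
  by apply: Finj; rewrite inE.
apply/seteqP; split=> [E [/Fsurj[s _ <-] xs]|_ [s /= sx <-]].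
  by exists s => //=; have [_] := xs _ xF; rewrite finset.sub1set.
by split; [exact: Ffacet|apply: hface_le; rewrite finset.sub1set].
Qed.

(** * Linear programming duality *)

Section LinearProgramming.
Variables (R : realType) (n : nat).

(* If c = sup w is not attained, then "x in P and c <= w x" is infeasible, and its
   Farkas certificate bounds w on P by some c - 1/l < c. *)
Lemma lp_attained (T : finType) (a : T -> 'rV[R]_n) (b : T -> R) w C :
    hpoly a b !=set0 -> (forall x, hpoly a b x -> dot w x <= C) ->
  exists2 z, hpoly a b z & forall x, hpoly a b x -> dot w x <= dot w z.
Proof.
move=> [x0 Px0] wC; apply: contrapT => noz.
pose V := ('rV[R]_n * R^o)%type.
pose X := dot w @` hpoly a b; pose c := sup X.
have hX : has_sup X.
  by split; [exists (dot w x0), x0|exists C => _ [x Px <-]; apply: wC].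
have xc x : hpoly a b x -> dot w x <= c.
  by move=> Px; apply: (sup_upper_bound hX); exists x.
(* Homogenization: for a solution [(y, t)] with [t > 0], the point [t^-1 *: y] would be a maximizer.
   Hence the system implies [t <= 0]. *)
pose f (i : option T) (z : V) : R :=
  if i is Some j then dot (a j) z.1 - b j * z.2 else c * z.2 - dot w z.1.
have [i|||l l0 lE] := @farkas R V _ [set: option T]%SET f (fun z => z.2).
- move=> k [y t] [y' t'].
  by case: i => [i|] /=; rewrite /GRing.scale /= dotDr dotZr; lra.
- by [].
- move=> [y t] /= yt; rewrite leNgt; apply/negP => t0; apply: noz.
  have Py : hpoly a b (t^-1 *: y).
    move=> i; rewrite dotZr ler_pdivrMl //.
    by have := yt (Some i); rewrite inE => /(_ isT) /=; lra.
  exists (t^-1 *: y) => // x /xc/le_trans; apply.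
  rewrite dotZr ler_pdivlMl //.
  by have := yt None; rewrite inE => /(_ isT) /=; lra.
have key x : hpoly a b x -> 1 <= l None * (c - dot w x).
  move=> Px; have := lE (x, 1); rewrite (bigD1 None) ?inE //= => ->.
  rewrite mulr1 gerDl; apply: sumr_le0 => -[i _|]; rewrite ?eqxx ?andbF //=.
  by rewrite mulr1 mulr_ge0_le0 // subr_le0.
have lN : 0 < l None.
  rewrite lt_neqAle l0 andbT; apply/eqP => l0'; have := key _ Px0.
  by rewrite -l0' mul0r ler10.
have [|_ [x Px <-]] := @sup_adherent _ X (l None)^-1 _ hX.
  by rewrite invr_gt0.
apply/negP; rewrite -leNgt -/c lerBrDr -lerBrDl -[leLHS]mulr1 ler_pdivrMl //.
exact: key.
Qed.

(** At a maximizer, [w] does not increase along directions in which no active functional increases,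
    so Farkas' lemma applies. *)
Lemma lp_dual (T : finType) (a : T -> 'rV[R]_n) (b : T -> R) w C :
    hpoly a b !=set0 -> (forall x, hpoly a b x -> dot w x <= C) ->
  exists (z : 'rV[R]_n) (l : T -> R), [/\ hpoly a b z, forall i, 0 <= l i
    & forall d, dot w d = \sum_(i in active a b z) l i * dot (a i) d].
Proof.
move=> P0 wC; have [z Pz zmax] := lp_attained P0 wC.
have [i||d dP|l l0 lE] :=
    @farkas R 'rV[R]_n T (active a b z) (fun i => dot (a i)) (dot w).
- exact: dot_scalar.
- exact: dot_scalar.
- have [t [t0 Pt _]] := step Pz dP; have := zmax _ Pt.
  by rewrite dotDr dotZr gerDl pmulr_rle0.
by exists z, l.
Qed.

(** Membership of [x] is a linear system in the summands, homogenized by [t], with the equation that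
    they add up to [t *: x]. If [x] is not in the sum, the system forces [t <= 0]; the Farkas
    multipliers of the equation form [w], and [t = 1] gives the gap [1]. *)
Lemma minkowski_separation (T K : finType) (A : {set T})
    (a : T -> K -> 'rV[R]_n) (b : T -> K -> R) x :
    ~ minkowski_sum A (fun i => hpoly (a i) (b i)) x ->
  exists w, forall q, minkowski_sum A (fun i => hpoly (a i) (b i)) q ->
    dot w q <= dot w x - 1.
Proof.
move=> nx; pose V := ({ffun T -> 'rV[R]_n} * R^o)%type.
pose g (k : 'I_n) (z : V) : R := (\sum_(i in A) z.1 i - z.2 *: x) 0 k.
have gs k : scalar (g k).
  move=> s [y t] [y' t']; rewrite /g /= -[s *: t]/(s * t).
  under eq_bigr do rewrite !ffunE.
  by rewrite big_split /= -scaler_sumr !mxE; lra.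
pose f (e : (T * K) + ('I_n * bool)) (z : V) : R :=
  match e with
  | inl (i, k) => if i \in A then dot (a i k) (z.1 i) - b i k * z.2 else 0
  | inr (k, s) => if s then g k z else - g k z
  end.
have fs e : scalar (f e).
  case: e => [[i k]|[k []]] s [y t] [y' t'] /=.
  - case: ifP => _; last by lra.
    by rewrite -[s *: t]/(s * t) !ffunE dotDr dotZr; lra.
  - exact: gs.
  - by rewrite gs; lra.
have [//||l l0 lE] := @farkas R V _ [set: _]%SET f (fun z => z.2) fs.
  move=> [y t] yt /=; rewrite leNgt; apply/negP => t0; apply: nx.
  have g0 k : (\sum_(i in A) y i) 0 k = t * x 0 k.
    have := yt (inr (k, true)); have := yt (inr (k, false)).
    by rewrite !inE /= /g /= !mxE => /(_ isT) + /(_ isT); lra.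
  exists (fun i => t^-1 *: y i) => [i iA k|].
    rewrite dotZr ler_pdivrMl //.
    by have := yt (inl (i, k)); rewrite inE /= iA => /(_ isT); lra.
  apply/rowP => k; rewrite -scaler_sumr mxE g0 mulrA mulVf ?mul1r //.
  exact: lt0r_neq0.
exists (\row_k (l (inr (k, false)) - l (inr (k, true)))) => q [y Py qE].
have := lE ([ffun i => y i], 1).
rewrite (eq_bigl predT) => [|e]; last by rewrite inE.
rewrite big_sumType /= => e1.
set s1 := \sum_(i : T * K) _ in e1; set s2 := \sum_(i : 'I_n * bool) _ in e1.
have s1_le0 : s1 <= 0.
  apply: sumr_le0 => -[i k] _; rewrite mulr_ge0_le0 //.
  by case: ifP => // iA; rewrite ffunE mulr1 subr_le0 Py.
have s2E : s2 = dot (\row_k (l (inr (k, false)) - l (inr (k, true)))) (x - q).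
  pose z : V := ([ffun i => y i], 1).
  transitivity (\sum_k \sum_(s : bool) l (inr (k, s)) * f (inr (k, s)) z).
    by rewrite pair_bigA; apply: eq_bigr => -[].
  apply: eq_bigr => k _.
  rewrite big_bool /= !mxE /g /= scale1r.
  under eq_bigr do rewrite ffunE.
  by rewrite -qE !mxE; lra.
by move: e1 s1_le0; rewrite s2E dotBr; lra.
Qed.

End LinearProgramming.

(** * Nested sets *)

Section NestedSets.
Variables (S : finType) (Delta : set {set S}) (B : {set {set S}}).
Implicit Types (I J U : {set S}) (N X : {set {set S}}).

Hypothesis Delta0 : Delta finset.set0.
Hypothesis Delta_sub : forall I J, I \subset J -> Delta J -> Delta I.
Hypothesis hB : building_set Delta B.

Lemma nested_subset N N' : N' \subset N -> nested Delta B N -> nested Delta B N'.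
Proof.
move=> N'N [NB h]; split; first exact: fintype.subset_trans NB.
by move=> X XN'; apply: h; apply: fintype.subset_trans N'N.
Qed.

Lemma nested1 I : I \in B -> nested Delta B [set I]%SET.
Proof.
move=> IB; split; first by rewrite finset.sub1set.
move=> X /subset_leq_card; rewrite cards1 => X1 X2 _.
by have := leq_trans X2 X1.
Qed.

Lemma nested0 : nested Delta B finset.set0.
Proof.
split; first by rewrite finset.sub0set.
by move=> X; rewrite finset.subset0 => /eqP ->; rewrite cards0.
Qed.

(** Nestedness concerns antichains only; the maximal members of [N] form one with the same union as
    [N]. *)
Definition maximal N : {set {set S}} := [set I | maxset (mem N) I]%SET.

Lemma maximal_sub N : maximal N \subset N.
Proof. by apply/fintype.subsetP => I; rewrite inE => /maxsetp. Qed.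

Lemma maximal_antichain N I J :
  I \in maximal N -> J \in maximal N -> I != J -> ~~ (I \subset J).
Proof.
rewrite !inE => /maxsetP[_ mI] /maxsetp NJ; apply: contra => IJ.
by rewrite (mI J NJ IJ).
Qed.

Lemma maximal_above N I : I \in N -> exists2 J, J \in maximal N & I \subset J.
Proof.
by move=> /(@maxset_exists _ (mem N))[J mJ IJ]; exists J; rewrite ?inE.
Qed.

Lemma cover_maximal N : finset.cover (maximal N) = finset.cover N.
Proof.
apply/eqP; rewrite finset.eqEsubset; apply/andP; split; apply/bigcupsP => I IN.
  by apply: finset.bigcup_sup; apply: (fintype.subsetP (maximal_sub N)).
have [J JX IJ] := maximal_above IN.
apply: fintype.subset_trans IJ _; exact: finset.bigcup_sup.
Qed.

Lemma nested_cover N : nested Delta B N -> Delta (finset.cover N).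
Proof.
case: hB => hB1 _ _ [NB h]; rewrite -cover_maximal.
have [le1|lt1] := leqP #|maximal N| 1; last first.
  exact: (h _ (maximal_sub N) lt1 (@maximal_antichain N)).1.
have [->|[I IX]] := finset.set_0Vmem (maximal N).
  by rewrite /finset.cover finset.big_set0.
have -> : maximal N = [set I]%SET.
  apply/esym/eqP; rewrite finset.eqEcard finset.sub1set IX cards1.
  exact: le1.
rewrite /finset.cover finset.big_set1.
apply: (hB1 _ _).2; apply: (fintype.subsetP NB).
by apply: (fintype.subsetP (maximal_sub N)).
Qed.

(* Joining J to the maximal sets of such a cover one at a time never leaves B,
   although the total union of an antichain of N is not in B. *)
Lemma nested_not_covered N J : nested Delta B N -> J \in B ->
  ~~ (J \subset finset.cover [set I in N | ~~ (J \subset I)]%SET).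
Proof.
move=> nN JB; have [hB1 _ hB3] := hB.
apply/negP => Jcov.
pose N' := [set I in N | ~~ (J \subset I) && (I :&: J != finset.set0)]%SET.
have N'N : N' \subset N by apply/fintype.subsetP => I; rewrite inE => /andP[].
have nN' := nested_subset N'N nN.
have JN' : J \subset finset.cover N'.
  apply/fintype.subsetP => s sJ.
  have /bigcupP[I] := fintype.subsetP Jcov _ sJ.
  rewrite inE => /andP[IN JI] sI; apply/bigcupP; exists I => //.
  by rewrite inE IN JI; apply/finset.set0Pn; exists s; rewrite inE sI.
have [le1|lt1] := leqP #|maximal N'| 1.
  have /finset.set0Pn[s sJ] := (hB1 _ JB).1.
  have /bigcupP[I IN' sI] := fintype.subsetP JN' _ sJ.
  have [K KX _] := maximal_above IN'.
  have XK : maximal N' = [set K]%SET.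
    by apply/esym/eqP; rewrite finset.eqEcard finset.sub1set KX cards1.
  move: JN'; rewrite -cover_maximal XK /finset.cover finset.big_set1 => JK.
  have := fintype.subsetP (maximal_sub N') _ KX.
  by rewrite inE JK andbF.
have [_ /negP] := nN'.2 _ (maximal_sub N') lt1 (@maximal_antichain N').
rewrite cover_maximal; apply.
suff grow (Y : {set {set S}}) : Y \subset N' -> J :|: finset.cover Y \in B.
  by have := grow N' (fintype.subxx _); rewrite (finset.setUidPr JN').
have [m] := ubnP #|Y|; elim: m Y => // m IH Y; rewrite ltnS => Ym YN'.
have [->|[I IY]] := finset.set_0Vmem Y.
  by rewrite /finset.cover finset.big_set0 finset.setU0.
have /IH YI : (#|Y :\ I| < m)%N by move: Ym; rewrite (cardsD1 I Y) IY.
have IN' := fintype.subsetP YN' _ IY.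
have -> : J :|: finset.cover Y = (J :|: finset.cover (Y :\ I)) :|: I.
  by rewrite /finset.cover (finset.big_setD1 I) //= finset.setUCA finset.setUC.
apply: hB3.
- by apply: YI; apply: fintype.subset_trans YN'; apply: finset.subsetDl.
- exact: (fintype.subsetP nN'.1).
- move: IN'; rewrite inE => /and3P[_ _ /finset.set0Pn[s]].
  rewrite inE => /andP[sI sJ].
  by apply/finset.set0Pn; exists s; rewrite !inE sJ sI.
apply: Delta_sub (nested_cover nN'); rewrite !finset.subUset JN' /=.
apply/andP; split; last exact: finset.bigcup_sup.
apply/bigcupsP => K; rewrite inE => /andP[_ KY].
by apply: finset.bigcup_sup; apply: (fintype.subsetP YN').
Qed.

(** Greedy induction on the support [D] of [l]: take a maximal [C] in [B] inside [D] and subtract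
    its indicator times the minimum of [l] on [C]. The support loses the minimizer [s1], so no set
    found later contains [s1]. *)
Lemma nested_decomposition (R : realType) (l : S -> R) :
    (forall s, 0 <= l s) -> Delta [set s | l s != 0]%SET ->
  exists (N : {set {set S}}) (mu : {set S} -> R),
    [/\ nested Delta B N, forall I, I \in N -> I \subset [set s | l s != 0]%SET,
        forall I, 0 <= mu I
      & forall s, l s = \sum_(I in N) mu I * (s \in I)%:R].
Proof.
have [hB1 hB2 hB3] := hB.
have [m] := ubnP #|[set s | l s != 0]%SET|; elim: m l => // m IH l.
set D := [set s | _]%SET; rewrite ltnS => Dm l0 DD.
have [D0|[s0 s0D]] := finset.set_0Vmem D.
  exists finset.set0, (fun=> 0); split=> //; first exact: nested0.
    by move=> I; rewrite inE.
  move=> s; rewrite finset.big_set0; apply/eqP.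
  have : s \notin D by rewrite D0 inE.
  by rewrite inE negbK.
have [C /maxsetP[/andP[CB CD] Cmax] _] :=
  @maxset_exists _ (fun I => (I \in B) && (I \subset D)) [set s0]%SET
    (introT andP (conj (hB2 s0) (etrans (finset.sub1set _ _) s0D))).
have /finset.set0Pn[s2 s2C] := (hB1 _ CB).1.
have [s1 s1C s1min] : exists2 s1, s1 \in C & forall s, s \in C -> l s1 <= l s.
  by case: (@arg_minP _ R S s2 (mem C) l s2C) => s1 ? ?; exists s1.
pose l' s := l s - l s1 * (s \in C)%:R.
have l'0 s : 0 <= l' s.
  rewrite /l'; case: (boolP (s \in C)) => sC; last by rewrite mulr0 subr0.
  by rewrite mulr1 subr_ge0 s1min.
pose D' := [set s | l' s != 0]%SET.
have D'D : D' \subset D :\ s1.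
  apply/fintype.subsetP => s; rewrite !inE /l'.
  have [->|ss1] := eqVneq s s1; first by rewrite s1C mulr1 subrr eqxx.
  apply: contra => /eqP ls; have := l'0 s; rewrite /l' ls sub0r => h.
  have := l0 s1; case: (s \in C) h; rewrite ?mulr1 ?mulr0 ?oppr0 //.
  by rewrite oppr_ge0 => ? ?; rewrite oppr_eq0 eq_le; apply/andP.
have s1D : s1 \in D by apply: (fintype.subsetP CD).
have D'm : (#|D'| < m)%N.
  apply: leq_trans Dm.
  by rewrite (cardsD1 s1 D) s1D ltnS; apply: subset_leq_card.
have [|N [mu [nN ND' mu0 l'E]]] := IH l' D'm l'0.
  by apply: Delta_sub DD; apply: fintype.subset_trans D'D (finset.subsetDl _ _).
have ND I : I \in N -> I \subset D :\ s1.
  by move=> /ND' h; apply: fintype.subset_trans h D'D.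
have CN : C \notin N.
  apply/negP => /ND/fintype.subsetP/(_ _ s1C).
  by rewrite !inE eqxx.
exists (C |: N), (fun I => if I == C then l s1 else mu I); split.
- split.
    by rewrite finset.subUset finset.sub1set CB nN.1.
  move=> X XN X2 Xanti; have [CX|CX] := boolP (C \in X); last first.
    apply: nN.2 => //; apply/fintype.subsetP => I IX.
    have := fintype.subsetP XN _ IX; rewrite !inE => /orP[/eqP IC|//].
    by rewrite -IC IX in CX.
  have coverD : finset.cover X \subset D.
    apply/bigcupsP => I /(fintype.subsetP XN); rewrite !inE => /orP[/eqP->//|/ND h].
    exact: fintype.subset_trans h (finset.subsetDl _ _).
  split; first exact: Delta_sub DD.
  (* Maximality of [C] forces the union, which contains it, to equal [C]; the antichain would then
     have another member inside [C]. *)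
  apply/negP => XB; have CcX : C \subset finset.cover X by apply: finset.bigcup_sup.
  have XC : finset.cover X = C by apply: Cmax; rewrite // XB coverD.
  have [I] : exists2 I, I \in X & I != C.
    have : (0 < #|X :\ C|)%N by move: X2; rewrite (cardsD1 C) CX.
    by rewrite card_gt0 => /finset.set0Pn[I]; rewrite !inE => /andP[? ?]; exists I.
  move=> IX IC; have := Xanti _ _ IX CX IC.
  by rewrite -XC finset.bigcup_sup.
- move=> I; rewrite !inE => /orP[/eqP->//|/ND h].
  exact: fintype.subset_trans h (finset.subsetDl _ _).
- by move=> I; case: ifP.
move=> s; rewrite finset.big_setU1 //= eqxx.
rewrite (eq_bigr (fun I => mu I * (s \in I)%:R)) => [|I IN]; last first.
  by rewrite ifN //; apply: contraNneq CN => <-.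
by rewrite -l'E /l' addrC subrK.
Qed.

End NestedSets.

(** * Sums of truncations *)

Lemma bigcap_hface (R : realType) (n : nat) (T : finType)
    (a : T -> 'rV[R]_n) (b : T -> R) (A : {set T}) : A != finset.set0 ->
  \bigcap_(i in [set` A]) hface a b [set i]%SET = hface a b A.
Proof.
move=> /finset.set0Pn[i0 i0A]; apply/seteqP; split=> x Ax; last first.
  by move=> i /= iA; apply: hface_le Ax; rewrite finset.sub1set.
split; first exact: (Ax i0 i0A).1.
by apply/fintype.subsetP => i /Ax[_]; rewrite finset.sub1set.
Qed.

Lemma dual_complex_hface (R : realType) (n : nat) (T : finType)
    (a : T -> 'rV[R]_n) (b : T -> R) : hpoly a b !=set0 ->
  dual_complex (fun i => hface a b [set i]%SET) =
    [set A | hface a b A !=set0].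
Proof.
move=> [x Px]; apply/funext => A; apply/propext; rewrite /dual_complex /=.
have [->|A0] := eqVneq A finset.set0; last by rewrite bigcap_hface.
split=> _; exists x; last by move=> i /=; rewrite inE.
by split; rewrite ?finset.sub0set.
Qed.

Lemma eq_minkowski_sum (R : realType) (n : nat) (T : finType) (A : {set T})
    (Q Q' : T -> set 'rV[R]_n) : (forall i, i \in A -> Q i = Q' i) ->
  minkowski_sum A Q = minkowski_sum A Q'.
Proof.
move=> QQ'; apply/seteqP.
by split=> _ [y yQ ->]; exists y => // i iA; have := yQ i iA; rewrite QQ'.
Qed.

Section TruncationSum.
Variables (R : realType) (n : nat) (S : finType).
Variables (v : S -> 'rV[R]_n) (h : S -> R).
Variables (B : {set {set S}}) (c : {set S} -> R).
Implicit Types (x y z d w : 'rV[R]_n) (I J U : {set S}) (N X : {set {set S}}).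

Definition normal I : 'rV[R]_n := \sum_(i in I) v i.

Definition height I : R := \sum_(i in I) h i.

Local Notation P := (hpoly v h).
Local Notation Delta := [set I : {set S} | hface v h I !=set0].

Hypothesis P0 : P !=set0.
Hypothesis Pindep : forall x, P x -> indep v (active v h x).
Hypothesis hB : building_set Delta B.
(** The truncation conditions in terms of index sets: the face of [U] meets that of [J] when
    [U :|: J] is in [Delta], and lies inside it when [J] is a subset of [U]. *)
Hypothesis cut_face : forall J x, J \in B ->
  hface v h J x -> c J < dot (normal J) x.
Hypothesis cut_meets : forall J U, J \in B ->
  Delta (U :|: J) -> ~~ (J \subset U) ->
  exists2 x, hface v h U x & dot (normal J) x = c J.
Hypothesis cut_misses : forall J U x, J \in B -> ~ Delta (U :|: J) ->
  hface v h U x -> dot (normal J) x < c J.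

Let Delta0 : Delta finset.set0.
Proof. by have [x Px] := P0; exists x; split; rewrite ?finset.sub0set. Qed.

Let Delta_sub I J : I \subset J -> Delta J -> Delta I.
Proof. by move=> IJ [x /(hface_le IJ)]; exists x. Qed.

Lemma dot_normal I x : dot (normal I) x = \sum_(i in I) dot (v i) x.
Proof. exact: dot_suml. Qed.

Lemma normal_le I x : P x -> dot (normal I) x <= height I.
Proof. by move=> Px; rewrite dot_normal ler_sum. Qed.

Lemma normal_eq I x : P x ->
  (dot (normal I) x == height I) = (I \subset active v h x).
Proof.
by move=> Px; rewrite dot_normal sum_tight.
Qed.

(* The maximum of [normal I] over the truncation [cutP J] below. *)
Definition supp J I : R :=
  if J \subset I then height (I :\: J) + c J else height I.

Definition tight J I x : bool :=
  if J \subset I then (I :\: J \subset active v h x) && (dot (normal J) x == c J)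
  else I \subset active v h x.

Lemma normal_setD J I x : J \subset I ->
  dot (normal I) x = dot (normal (I :\: J)) x + dot (normal J) x.
Proof.
move=> /finset.setIidPr IJ.
by rewrite !dot_normal (finset.big_setID J) /= IJ addrC.
Qed.

Lemma supp_le J I x : P x -> dot (normal J) x <= c J ->
  dot (normal I) x <= supp J I.
Proof.
move=> Px xJ; rewrite /supp; case: ifP => JI; last exact: normal_le.
by rewrite (normal_setD x JI) lerD // normal_le.
Qed.

Lemma supp_eq J I x : P x -> dot (normal J) x <= c J ->
  (dot (normal I) x == supp J I) = tight J I x.
Proof.
move=> Px xJ; rewrite /supp /tight; case: ifP => JI; last exact: normal_eq.
rewrite (normal_setD x JI) -normal_eq //; have := normal_le (I :\: J) Px.
move=> le; apply/eqP/andP => [e|[/eqP-> /eqP->]//].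
by split; apply/eqP; lra.
Qed.

(** * Common maximizers on the truncations *)

Definition cutP J x := P x /\ dot (normal J) x <= c J.

(** On the face of [U] every [I] in [N] is tight, provided the cut is tight too when [J] is inside
    [I]. If [U :|: J] is in [Delta], [cut_meets] gives such a point, as [J] is not inside [U].
    Otherwise no member of [N] contains [J], and [cut_misses] keeps the whole face. *)
Lemma nested_tight_point N J : nested Delta B N -> J \in B ->
  exists2 y, cutP J y & forall I, I \in N -> dot (normal I) y = supp J I.
Proof.
move=> nN JB.
pose U := finset.cover [set I in N | ~~ (J \subset I)]%SET :|:
  (finset.cover N :\: J).
have JU : ~~ (J \subset U).
  have := nested_not_covered Delta0 Delta_sub hB nN JB.
  apply: contra => /fintype.subsetP JU.
  by apply/fintype.subsetP => s sJ; have := JU _ sJ; rewrite !inE sJ orbF.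
have UN : U \subset finset.cover N.
  rewrite finset.subUset finset.subsetDl andbT; apply/bigcupsP => I.
  by rewrite inE => /andP[IN _]; apply: finset.bigcup_sup.
have DN := nested_cover Delta0 hB nN.
have tightU y I : I \in N -> hface v h U y ->
    (J \subset I -> dot (normal J) y = c J) -> tight J I y.
  move=> IN [Py yU] yJ; rewrite /tight; case: ifP => JI.
    rewrite yJ // eqxx andbT; apply: fintype.subset_trans yU.
    apply: fintype.subset_trans (finset.subsetUr _ _); apply: finset.setSD.
    exact: finset.bigcup_sup.
  apply: fintype.subset_trans yU; apply: fintype.subset_trans (finset.subsetUl _ _).
  by apply: finset.bigcup_sup; rewrite inE IN JI.
have [D|D] := pselect (Delta (U :|: J)).
  have [y Uy yJ] := cut_meets JB D JU.
  have yc : cutP J y by split; [exact: Uy.1|rewrite yJ].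
  by exists y => // I IN; apply/eqP; rewrite supp_eq ?yJ ?tightU//; exact: Uy.1.
have [y Uy] := Delta_sub UN DN; have yJ := cut_misses JB D Uy.
have yc : cutP J y by split; [exact: Uy.1|exact: ltW].
exists y => // I IN; apply/eqP; rewrite supp_eq ?(ltW yJ)//; last exact: Uy.1.
apply: tightU => // JI; case: D; apply: Delta_sub DN.
rewrite finset.subUset UN; apply: fintype.subset_trans JI _.
exact: finset.bigcup_sup.
Qed.

(** The members of an antichain [X] that do not contain [J] are active at [y J]. For [J] a member
    [I0], these are all the others, and [cut_misses] contradicts the tightness of [I0] unless the
    union is in [Delta]. For [J] the union, were it in [B], these are all members, so [y J] lies on
    the face that [cut_face] removes. *)
Lemma tight_nested N (y : {set S} -> 'rV[R]_n) : N \subset B ->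
    (forall J, J \in B -> cutP J (y J) /\
       forall I, I \in N -> dot (normal I) (y J) = supp J I) ->
  nested Delta B N.
Proof.
move=> NB yP; split=> // X XN X2 Xanti.
have XB I : I \in X -> I \in B.
  by move=> IX; rewrite (fintype.subsetP NB) ?(fintype.subsetP XN).
have tightX I J : I \in X -> J \in B -> tight J I (y J).
  move=> IX JB; have [[Py yJ] /(_ I)yI] := yP _ JB.
  by rewrite -supp_eq // yI ?(fintype.subsetP XN).
have sub_active I J : I \in X -> J \in B -> ~~ (J \subset I) ->
    I \subset active v h (y J).
  by move=> IX JB JI; have := tightX _ _ IX JB; rewrite /tight (negbTE JI).
have [I0 I0X] : exists I, I \in X.
  by apply/finset.set0Pn; rewrite -card_gt0 (leq_trans _ X2).
have I0B := XB _ I0X.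
have coverE : finset.cover (X :\ I0) :|: I0 = finset.cover X.
  by rewrite /finset.cover [in RHS](finset.big_setD1 I0) //= finset.setUC.
have D : Delta (finset.cover X).
  rewrite -coverE; apply: contrapT => nD.
  have [[Py _] /(_ I0)y0] := yP _ I0B.
  have : dot (normal I0) (y I0) < c I0.
    apply: (cut_misses I0B nD); split=> //.
    apply/bigcupsP => I; rewrite !inE => /andP[II0 IX].
    by apply: sub_active => //; apply: Xanti; rewrite // eq_sym.
  rewrite y0 ?(fintype.subsetP XN) // /supp fintype.subxx finset.setDv.
  by rewrite /height finset.big_set0 add0r ltxx.
split=> //; apply/negP => XinB.
have [[Py yc] _] := yP _ XinB.
suff /(cut_face XinB) : hface v h (finset.cover X) (y (finset.cover X)).
  by rewrite ltNge yc.
split=> //; apply/bigcupsP => I IX; apply: sub_active => //.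
have [I' I'X] : exists2 I', I' \in X & I' != I.
  have : (0 < #|X :\ I|)%N by move: X2; rewrite (cardsD1 I) IX.
  by rewrite card_gt0 => /finset.set0Pn[I']; rewrite !inE => /andP[? ?]; exists I'.
move=> I'I; apply: contra (Xanti _ _ I'X IX I'I).
move=> /(fintype.subset_trans _); apply.
exact: finset.bigcup_sup.
Qed.

(** A maximal [I0] has an element [s0] in no other member of [N], by [nested_not_covered]. A
    direction dual to [s0] corrects the value at [I0] and preserves the others, which are prescribed
    by induction. *)
Lemma nested_indep N : nested Delta B N -> indep normal N.
Proof.
have [m] := ubnP #|N|; elim: m N => // m IH N; rewrite ltnS => Nm nN be.
have [->|[J /maximal_above[I0 I0m _]]] := finset.set_0Vmem N.
  by exists 0 => I; rewrite inE.
have I0N : I0 \in N := fintype.subsetP (maximal_sub N) _ I0m.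
have [|d dE] := IH (N :\ I0) _ (nested_subset (finset.subsetDl _ _) nN) be.
  by move: Nm; rewrite (cardsD1 I0) I0N.
have I0B := fintype.subsetP nN.1 _ I0N.
have /fintype.subsetPn[s0 s0I0 s0N] :=
  nested_not_covered Delta0 Delta_sub hB nN I0B.
have s0I I : I \in N -> I != I0 -> s0 \notin I.
  move=> IN II0; apply: contra s0N => s0I; apply/bigcupP; exists I => //.
  rewrite inE IN; move: I0m; rewrite inE => /maxsetP[_ mI0].
  by apply: contra II0 => /(mI0 _ IN) ->.
have [x [Px xN]] := nested_cover Delta0 hB nN.
have [e eE] := Pindep Px (fun s => (s == s0)%:R).
have eI I : I \in N -> dot (normal I) e = (s0 \in I)%:R.
  move=> IN; rewrite dot_normal.
  rewrite (eq_bigr (fun s => (s == s0)%:R)) => [|s sI]; last first.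
    apply/eE/(fintype.subsetP xN); apply/bigcupP; by exists I.
  have [s0I'|s0I'] := boolP (s0 \in I).
    by rewrite (bigD1 s0) //= eqxx big1 ?addr0 // => s /andP[_ /negbTE->].
  by rewrite big1 // => s sI; case: eqP => // ss0; rewrite -ss0 sI in s0I'.
exists (d + (be I0 - dot (normal I0) d) *: e) => I IN.
rewrite dotDr dotZr eI //; have [->|II0] := eqVneq I I0.
  by rewrite s0I0 mulr1 addrC subrK.
by rewrite (negbTE (s0I _ IN II0)) mulr0 addr0 dE // !inE II0.
Qed.

(** * The Minkowski sum as an intersection of halfspaces *)

Definition sum_height I : R := \sum_(J in B) supp J I.

Lemma sum_le (y : {set S} -> 'rV[R]_n) I : (forall J, J \in B -> cutP J (y J)) ->
  dot (normal I) (\sum_(J in B) y J) <= sum_height I.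
Proof.
by move=> yP; rewrite dot_sumr; apply: ler_sum => J /yP[Py yJ]; apply: supp_le.
Qed.

Lemma sum_eq (y : {set S} -> 'rV[R]_n) I J :
    (forall J, J \in B -> cutP J (y J)) -> J \in B ->
    dot (normal I) (\sum_(J in B) y J) = sum_height I ->
  dot (normal I) (y J) = supp J I.
Proof.
move=> yP JB e.
have : \sum_(J in B) (supp J I - dot (normal I) (y J)) = 0.
  by rewrite sumrB -dot_sumr e subrr.
move/eqP; rewrite psumr_eq0 => [/seq.allP/(_ J)|K /yP[Py yK]]; last first.
  by rewrite subr_ge0 supp_le.
by rewrite mem_index_enum JB => /(_ isT); rewrite subr_eq0 => /eqP.
Qed.

Lemma nested_sum_point N : nested Delta B N -> exists2 x,
  minkowski_sum B cutP x & forall I, I \in N -> dot (normal I) x = sum_height I.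
Proof.
move=> nN.
have /choice[y yP] : forall J, exists y, J \in B ->
    cutP J y /\ forall I, I \in N -> dot (normal I) y = supp J I.
  move=> J; have [JB|_] := boolP (J \in B); last by exists 0.
  by have [y yJ yN] := nested_tight_point nN JB; exists y.
exists (\sum_(J in B) y J); first by exists y => // J /yP[].
by move=> I IN; rewrite dot_sumr; apply: eq_bigr => J /yP[_]; apply.
Qed.

Lemma cutP_hpoly J : cutP J =
  hpoly (fun k => if k is Some s then v s else normal J)
        (fun k => if k is Some s then h s else c J).
Proof.
apply/seteqP; split=> [x [Px xJ] [s|]|x Px] //.
by split=> [s|]; [apply: (Px (Some s))|apply: (Px None)].
Qed.

(** Without facets [B] is empty and the empty Minkowski sum is the point [0], which is not
    full-dimensional for [n > 0]. *)
Hypothesis S_gt0 : (0 < n)%N -> (0 < #|S|)%N.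

(* If x satisfies the right-hand inequalities but is not in the sum, a functional w
   separates it. Being bounded on P, w is a nonnegative combination of the v_s
   active at some point of P, hence of the normals of some nested set, and
   these normals attain all their bounds at one point of the sum. *)
Lemma sum_hpoly : minkowski_sum B cutP =
  hpoly (fun i : {I | I \in B} => normal (val i)) (fun i => sum_height (val i)).
Proof.
apply/seteqP; split=> [_ [y yP ->] I|x Mx]; first exact: sum_le.
apply: contrapT => nx.
have cutE : minkowski_sum B cutP = minkowski_sum B _ :=
  eq_minkowski_sum (fun J _ => cutP_hpoly J).
have [w wP] : exists w, forall q, minkowski_sum B cutP q -> dot w q <= dot w x - 1.
  by move: nx; rewrite cutE => /minkowski_separation.
have [q0 q0P _] := nested_sum_point (nested0 Delta B).
have [y0 y0P q0E] := q0P; have wq0 := wP _ q0P.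
(* [B] can only be empty in dimension zero, where no functional separates. *)
have [J0 J0B] : exists J, J \in B.
  apply: contrapT => noJ; have [_ hB2 _] := hB.
  have n0 : n = 0%N.
    apply/eqP; rewrite -leqn0 leqNgt; apply/negP => /S_gt0/card_gt0P[s _].
    by apply: noJ; exists [set s]%SET.
  have dot0 q : dot w q = 0.
    by rewrite /dot big1 // => i; have := ltn_ord i; rewrite {2}n0.
  by move: wq0; rewrite !dot0; lra.
have wrec d : (forall s, s \in [set: S]%SET -> dot (v s) d <= 0) -> dot w d <= 0.
  move=> dv; rewrite leNgt; apply/negP => wd.
  (* [d] is a recession direction of the sum, and with this [t] the point [q0 + t *: d] has the same
     [w]-value as [x], against the gap in [wP]. *)
  pose t := (dot w x - dot w q0) / dot w d.
  have t0 : 0 <= t by rewrite divr_ge0 ?(ltW wd) // subr_ge0; lra.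
  suff : minkowski_sum B cutP (q0 + t *: d).
    by move/wP; rewrite dotDr dotZr divfK ?gt_eqF //; lra.
  exists (fun J => y0 J + (if J == J0 then t *: d else 0)).
    move=> J /y0P[Py yJ]; case: ifP => _; last by rewrite addr0.
    split=> [s|].
      rewrite dotDr dotZr; have := dv s; rewrite inE => /(_ isT) vd.
      by have := Py s; nra.
    have : dot (normal J) d <= 0.
      by rewrite dot_normal; apply: sumr_le0 => s _; apply: dv; rewrite inE.
    by rewrite dotDr dotZr; nra.
  rewrite big_split /= -q0E; congr (_ + _).
  by rewrite (bigD1 J0) //= eqxx big1 ?addr0 // => J /andP[_ /negbTE->].
have [i||l l0 lE] := farkas (a := fun s => dot (v s)) _ _ wrec.
- exact: dot_scalar.
- exact: dot_scalar.
(* [nested_decomposition] needs coefficients supported on a set in [Delta]. By [lE], [w] is bounded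
   on [P], and duality gives coefficients supported on an active set. *)
have [z [k [Pz k0 kE]]] : exists (z : 'rV[R]_n) (k : S -> R), [/\ P z,
    forall s, 0 <= k s
    & forall d, dot w d = \sum_(s in active v h z) k s * dot (v s) d].
  apply: (@lp_dual _ _ _ v h w (\sum_(s in [set: S]%SET) l s * h s)) => // p Pp.
  by rewrite lE; apply: ler_sum => s _; rewrite ler_wpM2l.
pose k' s := if s \in active v h z then k s else 0.
have k'A : [set s | k' s != 0]%SET \subset active v h z.
  by apply/fintype.subsetP => s; rewrite inE /k'; case: ifP => // _; rewrite eqxx.
have [||N [mu [nN _ mu0 muE]]] := @nested_decomposition _ _ _ Delta_sub hB R k'.
- by move=> s; rewrite /k'; case: ifP.
- by exists z.
have wE d : dot w d = \sum_(I in N) mu I * dot (normal I) d.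
  rewrite kE; transitivity (\sum_s k' s * dot (v s) d).
    rewrite big_mkcond; apply: eq_bigr => s _; rewrite /k'.
    by case: ifP => // _; rewrite mul0r.
  under eq_bigr do rewrite muE mulr_suml.
  rewrite exchange_big /=; apply: eq_bigr => I _.
  rewrite dot_normal mulr_sumr [RHS]big_mkcond; apply: eq_bigr => s _ /=.
  by case: (s \in I); rewrite ?mulr1 // mulr0 mul0r.
have [q qP qN] := nested_sum_point nN.
have := wP _ qP; suff : dot w x <= dot w q by lra.
rewrite !wE; apply: ler_sum => I IN; rewrite ler_wpM2l // qN //.
have IB := fintype.subsetP nN.1 _ IN.
exact: (Mx (exist _ I IB)).
Qed.

(** The inequalities of [sum_hpoly] satisfy the criterion of [simple_hpoly]: each is tight
    somewhere, and those active at a point form a nested set, hence are independent. The isomorphism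
    sends the facet of [I] to the vertex [I]. *)
Theorem nestohedron_sum : nestohedron Delta B (minkowski_sum B cutP).
Proof.
pose T : finType := {I | I \in B}.
pose a (I : T) := normal (val I); pose b (I : T) := sum_height (val I).
have sumE : minkowski_sum B cutP = hpoly a b by exact: sum_hpoly.
have point (A : {set T}) : nested Delta B (val @: A) -> hface a b A !=set0.
  move=> nA; have [x xP xA] := nested_sum_point nA; exists x.
  split; first by rewrite -sumE.
  apply/fintype.subsetP => I IA; apply/activeP/xA.
  exact: imset_f.
have subB (A : {set T}) : val @: A \subset B.
  by apply/fintype.subsetP => _ /imsetP[I _ ->]; exact: valP.
have nestA x : hpoly a b x -> nested Delta B (val @: active a b x).
  move=> Qx; have : minkowski_sum B cutP x by rewrite sumE.
  move=> [y yP xE]; apply: (@tight_nested _ y) => // J JB; split; first exact: yP.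
  move=> _ /imsetP[I /activeP Ix ->]; apply: sum_eq => //.
  by rewrite -xE.
have Q0 : hpoly a b !=set0.
  have [|x [Qx _]] := point finset.set0; last by exists x.
  by rewrite finset.imset0; exact: nested0.
have Qtight (I : T) : exists2 x, hpoly a b x & I \in active a b x.
  have [|x [Qx]] := point [set I]%SET.
    by rewrite finset.imset_set1; apply: nested1; exact: valP.
  by rewrite finset.sub1set; exists x.
have Qindep x : hpoly a b x -> indep a (active a b x).
  move=> Qx be.
  have [d dE] := nested_indep (nestA _ Qx)
    (fun I => if insub I is Some i then be i else 0).
  exists d => I Ix; rewrite /a dE; last exact: imset_f.
  by rewrite valK.
rewrite sumE; split; first exact: simple_hpoly.
exists T, (fun I : T => hface a b [set I]%SET).
split; first exact: facet_family_hpoly.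
rewrite dual_complex_hface //.
have faceE (A : {set T}) : hface a b A !=set0 <-> nested Delta B (val @: A).
  split=> [[x [Qx xA]]|]; last exact: point.
  exact: nested_subset (imsetS _ xA) (nestA _ Qx).
exists val; split=> // [|A _]; last exact: faceE.
split=> [I _|I J _ _|I [IB _]].
- by apply: nested1; exact: valP.
- exact: val_inj.
- rewrite finset.sub1set in IB; exists (exist _ I IB) => //.
  by apply: point; rewrite finset.imset_set1; exact: nested1.
Qed.

End TruncationSum.

(** With [P] presented by its facet normals, simplicity gives independence of the active normals,
    and the truncations supply the three cut conditions. *)
Theorem proposition3p6p4 (R : realType) (n : nat) (P : set 'rV[R]_n)
    (S : finType) (F : S -> set 'rV[R]_n) (v : S -> 'rV[R]_n)
    (B : {set {set S}}) (PI : {set S} -> set 'rV[R]_n)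
    (hP : simple_polyhedron P)
    (hF : facet_family P F)
    (hv : forall s, outer_normal P (F s) (v s))
    (hS : (0 < n)%N -> (0 < #|S|)%N)
    (hB : building_set (dual_complex F) B)
    (hPI : forall I, I \in B ->
       is_truncation (\sum_(i in I) v i) P (\bigcap_(s in [set` I]) F s)
         (PI I)) :
  nestohedron (dual_complex F) B (minkowski_sum B PI).
Proof.
have [polyP dimP _] := hP; have [h [PE FE]] := facet_presentation polyP dimP hF hv.
have {}FE : F = (fun s => hface v h [set s]%SET) by exact/funext.
have P0 : hpoly v h !=set0 by rewrite -PE; exact: has_dim_nonempty dimP.
have Pindep x : hpoly v h x -> indep v (active v h x).
  by apply: simple_indep; rewrite -PE // -FE.
have DE : dual_complex F = [set I | hface v h I !=set0].
  by rewrite FE dual_complex_hface.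
rewrite DE in hB *; have [hB1 _ _] := hB.
have hfaceU U J : hface v h U `&` hface v h J = hface v h (U :|: J).
  apply/seteqP; split=> x; last first.
    by move=> [Px]; rewrite finset.subUset => /andP[].
  by move=> [[Px xU] [_ xJ]]; split; rewrite // finset.subUset xU.
have /choice[c cP] : forall I, exists c, I \in B ->
    truncates (normal v I) c (hpoly v h) (hface v h I) /\
    PI I = hpoly v h `&` halfspace (normal v I) c.
  move=> I; have [IB|_] := boolP (I \in B); last by exists 0.
  have [c] := hPI I IB; rewrite FE PE bigcap_hface => [cI|].
    by exists c.
  exact: (hB1 I IB).1.
rewrite (@eq_minkowski_sum _ _ _ _ _ (cutP v h c)) => [|I /cP[_ ->] //].
apply: nestohedron_sum => //.
- by move=> J x JB; have [[cJ _ _] _] := cP _ JB; apply: cJ.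
- move=> J U JB UJ JU; have [[_ cJ _] _] := cP _ JB.
  have [||x [Ux xJ]] := cJ (hface v h U) (hface_face _ _ _); last by exists x.
    by rewrite hfaceU.
  move=> sub; have [x /hface_le xU] := UJ.
  have Ux := xU _ (finset.subsetUl U J).
  (* A point active exactly on [U] would lie on the face of [J], forcing [J] to be a subset of
     [U]. *)
  have [z Pz zU] := exact_point Ux (Pindep _ Ux.1).
  have [_] : hface v h J z by apply: sub; split; rewrite ?zU.
  by rewrite zU (negPf JU).
- move=> J U x JB UJ; have [[_ _ cJ] _] := cP _ JB.
  apply: cJ; first exact: hface_face.
  by rewrite hfaceU; apply/eqP/negPn/negP => /set0P.
Qed.
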